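(* Let $F$ be a DeMorgan circuit computing a Boolean function $f:\{0,1\}^n\to\{0,1\}$. If $F$ has no $0$-hazards, then the monotone version $F^+$ of $F$ computes the upwards closure $f^{\uparrow}$ of $f$.
   Context: A DeMorgan circuit on $x_1,\dots,x_n$ has fan-in-2 AND/OR gates and inputs $0,1,x_i,\bar x_i$. Ternary logic: on $\{0,\mathfrak u,1\}$ (with $\mathfrak u=1/2$) AND is $\min$, OR is $\max$, NOT is $1-x$; so a circuit computes a function on $\{0,\mathfrak u,1\}^n$. A resolution of $\alpha\in\{0,\mathfrak u,1\}^n$ replaces each $\mathfrak u$ by $0$ or $1$; $S_\alpha$ is the set of resolutions. $F$ has a $0$-hazard at $\alpha$ if $F(a)=0$ for all $a\in S_\alpha$ but $F(\alpha)=\mathfrak u$. The upwards closure is $f^{\uparrow}(x)=\bigvee_{z\le x}f(z)$ (componentwise order). The monotone version $F^+$ is the monotone circuit obtained from $F$ by replacing every negated input literal $\bar x_i$ with the constant $1$. *)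

(* Defs.v *)
From mathcomp Require Import all_boot all_order.

Set Implicit Arguments.
Unset Strict Implicit.
Unset Printing Implicit Defensive.

Import Order.TTheory.

(* A node whose fan-in wires, if any, are among the s wires already available. *)
Inductive node (n s : nat) : Type :=
  | Const of bool
  | Lit of 'I_n
  | NegLit of 'I_n
  | And of 'I_s & 'I_s
  | Or of 'I_s & 'I_s.

Arguments Const {n s}.
Arguments Lit {n s}.
Arguments NegLit {n s}.
Arguments And {n s}.
Arguments Or {n s}.

(* A circuit DAG listed in topological order; wires may be reused arbitrarily
   often, so fan-out is unbounded. *)
Inductive program (n : nat) : nat -> Type :=
  | Empty : program n 0
  | Extend s : program n s -> node n s -> program n s.+1.

Arguments Empty {n}.

Record circuit (n : nat) := Circuit {
  num_wires : nat;
  wires : program n num_wires;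
  output : 'I_num_wires
}.

Section Evaluation.

Variables (T : Type) (cst : bool -> T) (neg : T -> T) (conj disj : T -> T -> T).

Definition eval_node n s (g : node n s) (x : 'I_n -> T) (w : 'I_s -> T) : T :=
  match g with
  | Const b => cst b
  | Lit i => x i
  | NegLit i => neg (x i)
  | And j k => conj (w j) (w k)
  | Or j k => disj (w j) (w k)
  end.

Fixpoint eval_program n s (p : program n s) (x : 'I_n -> T) : 'I_s -> T :=
  match p in program _ s return 'I_s -> T with
  | Empty => fun j => cst false
  | Extend _ p' g => fun j =>
      if unlift ord_max j is Some j' then eval_program p' x j'
      else eval_node g x (eval_program p' x)
  end.

Definition eval n (F : circuit n) (x : 'I_n -> T) : T :=
  eval_program (wires F) x (output F).

End Evaluation.

Definition boolean_eval n (F : circuit n) (a : {ffun 'I_n -> bool}) : bool :=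
  eval id negb andb orb F a.

Definition computes n (F : circuit n) (f : {ffun 'I_n -> bool} -> bool) : Prop :=
  forall a, boolean_eval F a = f a.

(* The truth value v in {0, 1/2, 1} is represented by the ordinal 2v; in
   particular negation 1 - v becomes 2 - i, which is rev_ord. *)
Definition ternary := 'I_3.

Definition tern_u : ternary := @Ordinal 3 1 isT.

Definition tern_of_bool (b : bool) : ternary := if b then ord_max else ord0.

Definition ternary_eval n (F : circuit n) (alpha : {ffun 'I_n -> ternary}) : ternary :=
  eval tern_of_bool (@rev_ord 3) Order.min Order.max F alpha.

Definition resolution n (alpha : {ffun 'I_n -> ternary}) (a : {ffun 'I_n -> bool}) : Prop :=
  forall i, alpha i != tern_u -> tern_of_bool (a i) = alpha i.

Definition zero_hazard n (F : circuit n) (alpha : {ffun 'I_n -> ternary}) : Prop :=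
  (forall a, resolution alpha a -> boolean_eval F a = false) /\
  ternary_eval F alpha = tern_u.

Definition upclosure n (f : {ffun 'I_n -> bool} -> bool) (x : {ffun 'I_n -> bool}) : bool :=
  \big[orb/false]_(z : {ffun 'I_n -> bool} | [forall i, (z i <= x i)%O]) f z.

Definition monotone_node n s (g : node n s) : node n s :=
  if g is NegLit _ then Const true else g.

Fixpoint monotone_program n s (p : program n s) : program n s :=
  match p with
  | Empty => Empty
  | Extend _ p' g => Extend (monotone_program p') (monotone_node g)
  end.

Definition monotone_version n (F : circuit n) : circuit n :=
  Circuit (monotone_program (wires F)) (output F).

(* Main.v *)
(** Let alpha be 0 where x is 0 and u where x is 1.  Its resolutions are exactly
    the z <= x.  Wire by wire, F^+(x) = 1 iff F(alpha) <> 0: on alpha a negated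
    literal is never 0, just as in F^+ it is 1.  If F(alpha) = 1 then F is 1 at
    every resolution, and if F(alpha) = u then the absence of a 0-hazard yields
    a resolution at which F is 1. *)

Require Import Defs.
From mathcomp Require Import all_boot all_order.

Set Implicit Arguments.
Unset Strict Implicit.
Unset Printing Implicit Defensive.

Import Order.TTheory.

(** One induction on the program serves every later comparison of two evaluations. Negation occurs
    only at input literals, so [R] has to survive it only there, which admits relations that are not
    symmetric under negation. *)
Lemma eval_rel (T1 T2 : Type) (R : T1 -> T2 -> Prop)
    (cst1 : bool -> T1) (neg1 : T1 -> T1) (conj1 disj1 : T1 -> T1 -> T1)
    (cst2 : bool -> T2) (neg2 : T2 -> T2) (conj2 disj2 : T2 -> T2 -> T2)
    n (F : circuit n) (x1 : 'I_n -> T1) (x2 : 'I_n -> T2) :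
  (forall b, R (cst1 b) (cst2 b)) ->
  (forall i, R (x1 i) (x2 i)) ->
  (forall i, R (neg1 (x1 i)) (neg2 (x2 i))) ->
  (forall s1 s2 t1 t2, R s1 s2 -> R t1 t2 -> R (conj1 s1 t1) (conj2 s2 t2)) ->
  (forall s1 s2 t1 t2, R s1 s2 -> R t1 t2 -> R (disj1 s1 t1) (disj2 s2 t2)) ->
  R (eval cst1 neg1 conj1 disj1 F x1) (eval cst2 neg2 conj2 disj2 F x2).
Proof.
move=> Rcst Rx Rneg Rconj Rdisj; rewrite /eval.
(* The output is generalised so that the induction hypothesis covers both wires feeding a gate; the
   empty program yields the default [cst false]. *)
elim: (wires F) (output F) => [|s p IHp g] j /=; first exact: Rcst.
case: (unlift _ j) => [j'|]; first exact: IHp.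
by case: g => [b|i|i|k l|k l] /=; auto.
Qed.

(** This puts both sides of a comparison on the same circuit [F], as [eval_rel] requires. *)
Lemma eval_monotone_version (T : Type) (cst : bool -> T) (neg : T -> T)
    (conj disj : T -> T -> T) n (F : circuit n) (x : 'I_n -> T) :
  eval cst neg conj disj (monotone_version F) x =
  eval cst (fun=> cst true) conj disj F x.
Proof.
rewrite /eval /=; elim: (wires F) (output F) => [|s p IHp g] j //=.
case: (unlift _ j) => [j'|]; first exact: IHp.
by case: g => [b|i|i|k l|k l] //=; rewrite !IHp.
Qed.

Lemma lt_tern_of_bool (c : ternary) (b : bool) :
  (c < ord_max)%O -> (c < tern_of_bool b)%O = b.
Proof. by case: b => //= _; rewrite ltEord. Qed.

Lemma ternary_eval_sound n (F : circuit n) (alpha : {ffun 'I_n -> ternary}) a :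
  resolution alpha a -> (tern_u < ternary_eval F alpha)%O -> boolean_eval F a.
Proof.
move=> res; rewrite /ternary_eval /boolean_eval.
apply: (eval_rel (R := fun (t : ternary) (b : bool) => (tern_u < t)%O -> b)).
- by move=> b; rewrite lt_tern_of_bool.
(* A literal above [tern_u] differs from [tern_u], so the resolution must agree with it. *)
- move=> i u_lt; rewrite -(@lt_tern_of_bool tern_u (a i)) // res //.
  by rewrite gt_eqF.
- move=> i; have := res i.
  by case: (alpha i) (a i) => [[|[|[|]]] //= lt_i3] [] // /(_ isT).
- by move=> s1 s2 t1 t2 Rs Rt; rewrite lt_min => /andP[/Rs-> /Rt->].
- by move=> s1 s2 t1 t2 Rs Rt; rewrite lt_max => /orP[/Rs-> | /Rt->]; rewrite ?orbT.
Qed.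

Lemma monotone_version_above n (F : circuit n) (z x : {ffun 'I_n -> bool}) :
  (forall i, (z i <= x i)%O) ->
  boolean_eval F z -> boolean_eval (monotone_version F) x.
Proof.
move=> le_zx; rewrite /boolean_eval eval_monotone_version.
(* Implication passes through AND and OR, and any value of a negated literal implies the constant
   1. *)
apply: (eval_rel (R := fun b c : bool => b -> c)) => //.
- by move=> i; have := le_zx i; case: (z i) (x i) => [] [].
- by move=> s1 s2 t1 t2 Rs Rt /andP[/Rs-> /Rt->].
- by move=> s1 s2 t1 t2 Rs Rt /orP[/Rs-> | /Rt->]; rewrite ?orbT.
Qed.

Definition blur n (x : {ffun 'I_n -> bool}) : {ffun 'I_n -> ternary} :=
  [ffun i => if x i then tern_u else ord0].

Lemma resolution_blur n (x a : {ffun 'I_n -> bool}) :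
  resolution (blur x) a <-> forall i, (a i <= x i)%O.
Proof.
by split=> H i; have := H i; rewrite ffunE; case: (x i) (a i) => [] [] // /(_ isT).
Qed.

(** The threshold [ord0 < t] turns min into AND and max into OR, so equality with it propagates from
    the inputs to every gate. *)
Lemma monotone_version_blur n (F : circuit n) (x : {ffun 'I_n -> bool}) :
  boolean_eval (monotone_version F) x = (ord0 < ternary_eval F (blur x))%O.
Proof.
rewrite /boolean_eval eval_monotone_version /ternary_eval.
apply: (eval_rel (R := fun (b : bool) (t : ternary) => b = (ord0 < t)%O)).
- by move=> b; rewrite lt_tern_of_bool.
- by move=> i; rewrite ffunE; case: (x i).
- by move=> i; rewrite ffunE; case: (x i).
- by move=> s1 s2 t1 t2 -> ->; rewrite lt_min.
- by move=> s1 s2 t1 t2 -> ->; rewrite lt_max.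
Qed.

Lemma upclosureP n (f : {ffun 'I_n -> bool} -> bool) (x : {ffun 'I_n -> bool}) :
  reflect (exists2 z : {ffun 'I_n -> bool}, forall i, (z i <= x i)%O & f z)
          (upclosure f x).
Proof.
rewrite /upclosure big_orE; apply: (iffP existsP) => [[z /andP[/forallP]]|[z le_zx fz]].
  by exists z.
by exists z; rewrite fz andbT; apply/forallP.
Qed.

Theorem theorem1 (n : nat) (F : circuit n) (f : {ffun 'I_n -> bool} -> bool)
  (hf : computes F f)
  (hF : forall alpha : {ffun 'I_n -> ternary}, ~ zero_hazard F alpha) :
  computes (monotone_version F) (upclosure f).
Proof.
move=> x; apply/idP/upclosureP => [|[z le_zx]]; last first.
  by rewrite -hf; apply: monotone_version_above.
rewrite monotone_version_blur => Fgt0.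
case: (ltgtP (ternary_eval F (blur x)) tern_u) => [Flt|Fgt|Fu].
- by move: Fgt0 Flt; case: (ternary_eval _ _) => [[|[|[|]]]].
(* The point [x] is itself a resolution of [blur x], the largest one. *)
- exists x => //; rewrite -hf; apply: ternary_eval_sound Fgt.
  exact/resolution_blur.
(* Passing back to the boolean [upclosure f x] allows arguing by contradiction: with no witness
   below [x], [blur x] would be a 0-hazard. *)
apply/upclosureP; apply: contraT => /upclosureP f0.
case: (hF (blur x)); split=> // a /resolution_blur le_ax.
by rewrite hf; apply/negP => fa; apply: f0; exists a.
Qed.
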